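(* Let $\mathbb{T}$ be a time scale that is unbounded above and has bounded graininess, and let $A(t)\in\mathbb{R}^{n\times n}$, $B(t)\in\mathbb{R}^{n\times m}$, $C(t)\in\mathbb{R}^{p\times n}$ be rd-continuous matrix functions on $\mathbb{T}$ with $A$ regressive. Suppose the regressive linear system $$x^{\Delta}(t)=A(t)x(t)+B(t)u(t),\quad x(t_0)=x_0,\qquad y(t)=C(t)x(t),$$ is uniformly exponentially stable, and there exist constants $\beta$ and $\alpha$ such that $\|B(t)\|\le\beta$ and $\|C(t)\|\le\alpha$ for all $t\in\mathbb{T}$. Then the state equation is also uniformly bounded-input, bounded-output stable.
   Context: A time scale $\mathbb{T}$ is a nonempty closed subset of $\mathbb{R}$, with forward jump operator $\sigma(t)=\inf\{s\in\mathbb{T}:s>t\}$ and graininess $\mu(t)=\sigma(t)-t$; $f^\Delta$ denotes the delta derivative and $\int f(t)\,\Delta t$ the delta integral. A function is rd-continuous if it is continuous at right-dense points of $\mathbb{T}$ and has finite left limits at left-dense points. $A$ is regressive if $I+\mu(t)A(t)$ is invertible for all $t\in\mathbb{T}$. $\Phi_A(t,s)$ is the transition matrix: the unique solution $X(t)$ of $X^\Delta(t)=A(t)X(t)$, $X(s)=I$. For a scalar constant $c$, $e_c(t,s)$ is the solution of the scalar equation $x^\Delta=cx$, $x(s)=1$, and $c\in\mathcal{R}^+$ means $1+\mu(t)c>0$ for all $t\in\mathbb{T}$. The system is uniformly exponentially stable if its unforced equation $x^\Delta=A(t)x$ satisfies: there exist constants $\gamma,\lambda>0$ with $-\lambda\in\mathcal{R}^+$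 such that for any $t_0\in\mathbb{T}$ and any $x(t_0)$ the corresponding solution satisfies $\|x(t)\|\le\|x(t_0)\|\,\gamma\,e_{-\lambda}(t,t_0)$ for all $t\ge t_0$ in $\mathbb{T}$. The system is uniformly bounded-input, bounded-output (BIBO) stable if there exists a finite constant $\eta$ such that for any $t_0\in\mathbb{T}$ and any (rd-continuous) input $u(t)$ the corresponding zero-state response $y(t)=\int_{t_0}^{t}C(t)\Phi_A(t,\sigma(s))B(s)u(s)\,\Delta s$ satisfies $\sup_{t\ge t_0}\|y(t)\|\le\eta\,\sup_{t\ge t_0}\|u(t)\|$. *)

(* Defs.v *)
From HB Require Import structures.
From mathcomp Require Import all_boot all_order all_algebra.
From mathcomp Require Import all_classical all_reals all_analysis.

Set Implicit Arguments.
Unset Strict Implicit.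
Unset Printing Implicit Defensive.

Import Order.TTheory GRing.Theory Num.Theory.
Import numFieldNormedType.Exports.
Local Open Scope classical_set_scope.
Local Open Scope ring_scope.

(* A function on a time scale T is a function on R of which only the values on
   T matter. Matrix-valued functions are differentiated, integrated and tested
   for rd-continuity entry by entry. *)

Definition time_scale (R : realType) (T : set R) : Prop :=
  closed T /\ T !=set0.

Definition unbounded_above (R : realType) (T : set R) : Prop :=
  forall M : R, exists2 t, T t & M < t.

(* Since [inf set0 = 0], this is the usual jump operator only when t is not
   the maximum of T; the time scales used below are unbounded above. *)
Definition sigma (R : realType) (T : set R) (t : R) : R :=
  inf [set s | T s /\ t < s].

Definition rho (R : realType) (T : set R) (t : R) : R :=
  sup [set s | T s /\ s < t].

Definition mu (R : realType) (T : set R) (t : R) : R := sigma T t - t.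

Definition bounded_graininess (R : realType) (T : set R) : Prop :=
  exists M : R, forall t, T t -> mu T t <= M.

Definition right_dense (R : realType) (T : set R) (t : R) : Prop :=
  T t /\ sigma T t = t.

(* The minimum of T, if any, is not left-dense. *)
Definition left_dense (R : realType) (T : set R) (t : R) : Prop :=
  [/\ T t, exists s, T s /\ s < t & rho T t = t].

Definition rd_continuous (R : realType) (T : set R) (f : R -> R) : Prop :=
  (forall t, right_dense T t -> f s @[s --> within T (nbhs t)] --> f t) /\
  (forall t, left_dense T t ->
     exists l : R, f s @[s --> within T (at_left t)] --> l).

Definition rd_continuous_mx (R : realType) (T : set R) (m n : nat)
    (f : R -> 'M[R]_(m, n)) : Prop :=
  forall i j, rd_continuous T (fun t => f t i j).

(* "f is delta differentiable at t with f^Delta(t) = l" *)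
Definition is_delta_deriv (R : realType) (T : set R) (f : R -> R)
    (t l : R) : Prop :=
  forall eps : R, 0 < eps ->
    \forall s \near within T (nbhs t),
      `|f (sigma T t) - f s - l * (sigma T t - s)| <= eps * `|sigma T t - s|.

Definition is_delta_deriv_mx (R : realType) (T : set R) (m n : nat)
    (f : R -> 'M[R]_(m, n)) (t : R) (l : 'M[R]_(m, n)) : Prop :=
  forall i j, is_delta_deriv T (fun s => f s i j) t (l i j).

Definition delta_antideriv (R : realType) (T : set R) (f F : R -> R) : Prop :=
  forall t, T t -> is_delta_deriv T F t (f t).

(* The Cauchy delta integral, F(b) - F(a) for an antiderivative F of f on T
   (which exists when f is rd-continuous); 0 if there is none. *)
Definition delta_integral (R : realType) (T : set R) (f : R -> R)
    (a b : R) : R :=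
  let F := xget (fun=> 0) [set F | delta_antideriv T f F] in F b - F a.

Definition delta_integral_mx (R : realType) (T : set R) (m n : nat)
    (f : R -> 'M[R]_(m, n)) (a b : R) : 'M[R]_(m, n) :=
  \matrix_(i, j) delta_integral T (fun s => f s i j) a b.

Definition regressive (R : realType) (T : set R) (n : nat)
    (A : R -> 'M[R]_n) : Prop :=
  forall t, T t -> 1%:M + mu T t *: A t \in unitmx.

(* X^Delta = A X on T; k = 1 for trajectories, k = n for matrix solutions. *)
Definition solves (R : realType) (T : set R) (n k : nat) (A : R -> 'M[R]_n)
    (X : R -> 'M[R]_(n, k)) : Prop :=
  forall t, T t -> is_delta_deriv_mx T X t (A t *m X t).

Definition transition (R : realType) (T : set R) (n : nat) (A : R -> 'M[R]_n)
    (t s : R) : 'M[R]_n :=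
  xget (fun=> 0) [set X : R -> 'M[R]_n | solves T A X /\ X s = 1%:M] t.

(* e_c(t, s) *)
Definition ts_exp (R : realType) (T : set R) (c t s : R) : R :=
  xget (fun=> 0) [set x : R -> R |
    (forall r, T r -> is_delta_deriv T x r (c * x r)) /\ x s = 1] t.

Definition positively_regressive (R : realType) (T : set R) (c : R) : Prop :=
  forall t, T t -> 0 < 1 + mu T t * c.

(* Euclidean norm; the library norm on matrices is the max norm. *)
Definition enorm (R : realType) (n : nat) (x : 'cV[R]_n) : R :=
  Num.sqrt (\sum_i x i 0 ^+ 2).

(* The matrix norm induced by [enorm]. *)
Definition opnorm (R : realType) (m n : nat) (M : 'M[R]_(m, n)) : R :=
  sup [set enorm (M *m x) | x in [set x : 'cV[R]_n | enorm x <= 1]].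

Definition uniformly_exp_stable (R : realType) (T : set R) (n : nat)
    (A : R -> 'M[R]_n) : Prop :=
  exists gamma lambda : R,
    [/\ 0 < gamma, 0 < lambda, positively_regressive T (- lambda) &
      forall (t0 : R) (x : R -> 'cV[R]_n), T t0 -> solves T A x ->
      forall t, T t -> t0 <= t ->
        enorm (x t) <= enorm (x t0) * gamma * ts_exp T (- lambda) t t0].

Definition zero_state_response (R : realType) (T : set R) (n m p : nat)
    (A : R -> 'M[R]_n) (B : R -> 'M[R]_(n, m)) (C : R -> 'M[R]_(p, n))
    (u : R -> 'cV[R]_m) (t0 t : R) : 'cV[R]_p :=
  delta_integral_mx T
    (fun s => C t *m transition T A t (sigma T s) *m B s *m u s) t0 t.

(* sup over t >= t0 in T of ||f(t)||, possibly +oo *)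
Definition sup_norm_from (R : realType) (T : set R) (n : nat) (t0 : R)
    (f : R -> 'cV[R]_n) : \bar R :=
  ereal_sup [set (enorm (f t))%:E | t in [set t | T t /\ t0 <= t]].

Definition uniformly_BIBO_stable (R : realType) (T : set R) (n m p : nat)
    (A : R -> 'M[R]_n) (B : R -> 'M[R]_(n, m)) (C : R -> 'M[R]_(p, n)) : Prop :=
  exists eta : R, forall (t0 : R) (u : R -> 'cV[R]_m),
    T t0 -> rd_continuous_mx T u ->
    (sup_norm_from T t0 (zero_state_response T A B C u t0)
       <= eta%:E * sup_norm_from T t0 u)%E.

(* Main.v *)
(* By the stability hypothesis, |Phi(t, sigma s) v| <= gamma |v| e(t, sigma s)
   with e = e_{-lambda}, so the integrand of the response is bounded by
   K e(t, sigma s), K = alpha beta gamma sup|u|. As s |-> e(t, s) / lambda is an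
   antiderivative of e(t, sigma s) and takes values in [0, 1 / lambda] for
   s <= t, the mean value inequality bounds the integral by K / lambda.
   No existence theorem is needed: where a transition matrix, an exponential
   or an antiderivative does not exist, its [xget] default makes the quantity
   to be bounded vanish. *)

Require Import Defs.
From HB Require Import structures.
From mathcomp Require Import all_boot all_order all_algebra.
From mathcomp Require Import all_classical all_reals all_analysis.
From mathcomp Require Import ring lra.

Import Order.TTheory GRing.Theory Num.Theory.
Import numFieldNormedType.Exports.
Local Open Scope classical_set_scope.
Local Open Scope ring_scope.

Set Implicit Arguments.
Unset Strict Implicit.

(** * Time scales *)

Lemma near_within_nbhsP (R : realType) (T : set R) (t : R) (P : R -> Prop) :
  (\forall s \near within T (nbhs t), P s) <->
  (exists2 d : R, 0 < d & forall s, T s -> `|s - t| < d -> P s).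
Proof.
rewrite near_withinE; split.
  move=> /nbhs_ballP[d /= d0 dP]; exists d => // s Ts st.
  by apply: dP => //; rewrite /ball /= distrC.
move=> [d d0 dP]; apply/nbhs_ballP; exists d => //= s.
by rewrite /ball /= distrC => st Ts; exact: dP.
Qed.

Lemma closed_approx (R : realType) (T : set R) (t : R) : closed T ->
  (forall e, 0 < e -> exists2 s, T s & `|t - s| < e) -> T t.
Proof.
move=> Tc Tt; apply: Tc => B /nbhs_ballP[e /= e0 eB].
by have [s Ts ts] := Tt _ e0; exists s; split => //; exact: eB.
Qed.

Lemma closed_inf (R : realType) (T S : set R) :
  closed T -> S `<=` T -> has_inf S -> T (inf S).
Proof.
move=> Tc ST Si; apply: (closed_approx Tc) => e e0.
have [s Ss se] := inf_adherent e0 Si; exists s; first exact: ST.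
by have := ge_inf Si.2 Ss; rewrite distrC ltr_norml => ?; lra.
Qed.

Lemma closed_sup (R : realType) (T S : set R) :
  closed T -> S `<=` T -> has_sup S -> T (sup S).
Proof.
move=> Tc ST Si; apply: (closed_approx Tc) => e e0.
have [s Ss se] := sup_adherent e0 Si; exists s; first exact: ST.
by have := ub_le_sup Si.2 Ss; rewrite ltr_norml => ?; lra.
Qed.

Lemma has_inf_jump (R : realType) (T : set R) (t : R) :
  unbounded_above T -> has_inf [set s | T s /\ t < s].
Proof.
move=> Tu; split; first by have [s Ts ts] := Tu t; exists s.
by exists t => s /= [_ /ltW].
Qed.

Lemma sigma_ge (R : realType) (T : set R) (t : R) :
  unbounded_above T -> t <= sigma T t.
Proof.
move=> Tu; apply: lb_le_inf; first exact: (has_inf_jump t Tu).1.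
by move=> s /= [_ /ltW].
Qed.

Lemma sigma_le (R : realType) (T : set R) (t s : R) :
  unbounded_above T -> T s -> t < s -> sigma T t <= s.
Proof. by move=> Tu Ts ts; apply: (ge_inf (has_inf_jump t Tu).2). Qed.

Lemma sigma_in (R : realType) (T : set R) (t : R) :
  closed T -> unbounded_above T -> T (sigma T t).
Proof.
move=> Tc Tu; apply: closed_inf => //; last exact: has_inf_jump.
by move=> s /= [].
Qed.

(** Induction along [T]. The infimum of the counterexamples from [a] on lies in [T], which is
    closed. [P] holds there by the start, jump or left-limit clause, and counterexamples then
    accumulate at it from the right, which the right-dense clause excludes. *)
Lemma time_scale_ind (R : realType) (T : set R) (a : R) (P : R -> Prop) :
  closed T -> unbounded_above T -> T a ->
  P a ->
  (forall t, T t -> a <= t -> P t -> t < sigma T t -> P (sigma T t)) ->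
  (forall t, T t -> a <= t -> P t -> sigma T t = t ->
    \forall s \near within T (nbhs t), t < s -> P s) ->
  (forall t, T t -> a < t -> (forall r, r < t -> exists s, T s /\ r < s < t) ->
    (forall s, T s -> a <= s -> s < t -> P s) -> P t) ->
  forall t, T t -> a <= t -> P t.
Proof.
move=> Tc Tu Ta Pa Pscat Pdense Pleft t1 Tt1 at1; apply: contrapT => nPt1.
pose S := [set s | [/\ T s, a <= s & ~ P s]].
have Si : has_inf S by split; [exists t1|exists a => s []].
have Tinf : T (inf S) by apply: closed_inf Si => // s [].
set c := inf S in Tinf.
have ac : a <= c by apply: lb_le_inf; [exists t1|move=> s []].
have Pbelow s : T s -> a <= s -> s < c -> P s.
  move=> Ts as_ sc; apply: contrapT => nPs.
  by have := ge_inf Si.2 (And3 Ts as_ nPs); rewrite leNgt sc.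
have Pc : P c.
  have [<-//|neq] := eqVneq a c.
  have {neq} altc : a < c by rewrite lt_neqAle neq.
  have [ld|] := pselect (forall r, r < c -> exists s, T s /\ r < s < c).
    exact: Pleft.
  move=> /existsNP[r /not_implyP[rc nr]].
  (* Here [c] is isolated on the left, so the supremum [b] of the points of [T] below [c] stays
     below [c], and [c] is the jump of [b]. *)
  pose L := [set s | T s /\ s < c].
  have Ls : has_sup L by split; [exists a|exists c => s [_ /ltW]].
  have TL : T (sup L) by apply: closed_sup Ls => // s [].
  set b := sup L in TL.
  have br : b <= r.
    apply: ge_sup; first by exists a.
    move=> s [Ts sc]; rewrite leNgt; apply/negP => rs.
    by apply: nr; exists s; rewrite rs.
  have ab : a <= b by apply: (ub_le_sup Ls.2).
  have bc : b < c by apply: le_lt_trans rc.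
  have sb : sigma T b = c.
    apply/eqP; rewrite eq_le sigma_le //=; apply: lb_le_inf; first by exists c.
    move=> s /= [Ts bs]; rewrite leNgt; apply/negP => sc.
    by have := ub_le_sup Ls.2 (conj Ts sc); rewrite leNgt bs.
  by rewrite -sb; apply: Pscat; rewrite ?sb //; exact: Pbelow.
(* As [P c] holds, the infimum is not attained: counterexamples come arbitrarily close to [c] from
   the right, so [c] has no gap after it. *)
have cinf d : 0 < d -> exists s, [/\ T s, ~ P s, c < s & s < c + d].
  move=> d0; have [s [Ts as_ nPs] sd] := inf_adherent d0 Si.
  have cs : c <= s by apply: (ge_inf Si.2).
  exists s; split => //; rewrite lt_neqAle cs andbT.
  by apply/eqP => cs'; apply: nPs; rewrite -cs'.
have sc : sigma T c = c.
  apply/eqP; rewrite eq_le sigma_ge // andbT leNgt; apply/negP => csc.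
  have [s [Ts _ cs]] := cinf (sigma T c - c) ltac:(by rewrite subr_gt0).
  by have := sigma_le Tu Ts cs; rewrite addrC subrK leNgt => /negP.
have /near_within_nbhsP[d d0 dP] := Pdense c Tinf ac Pc sc.
have [s [Ts nPs cs scd]] := cinf d d0.
by apply: nPs; apply: dP => //; rewrite ger0_norm; lra.
Qed.

(** * Delta derivatives *)

(** The point [s = t] is itself admissible in the definition of the delta derivative, so the error
    there is at most [eps * |mu T t|] for every [eps > 0]. *)
Lemma delta_deriv_jump (R : realType) (T : set R) (F : R -> R) (t l : R) :
  T t -> is_delta_deriv T F t l -> F (sigma T t) = F t + l * mu T t.
Proof.
move=> Tt dF; suff /eqP : `|F (sigma T t) - F t - l * mu T t| <= 0.
  by rewrite normr_le0 => /eqP; lra.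
apply/ler_addgt0Pl => e e0; rewrite addr0.
have k0 : 0 < `|mu T t| + 1 by rewrite ltr_wpDl.
have /near_within_nbhsP[d d0 dP] := dF (e / (`|mu T t| + 1)) (divr_gt0 e0 k0).
have := dP t Tt; rewrite subrr normr0 => /(_ d0) /le_trans; apply.
by rewrite -/(mu T t) mulrAC ler_pdivrMr // ler_pM2l // lerDl.
Qed.

(** The jump formula recentres the definition from [sigma T t] to [t]; at a right-dense point this
    is the usual first-order expansion. *)
Lemma delta_deriv_expand (R : realType) (T : set R) (F : R -> R) (t l e : R) :
  T t -> is_delta_deriv T F t l -> 0 < e ->
  exists2 d : R, 0 < d & forall s, T s -> `|s - t| < d ->
    `|F s - F t - l * (s - t)| <= e * `|sigma T t - s|.
Proof.
move=> Tt dF e0; have /near_within_nbhsP[d d0 dP] := dF e e0.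
exists d => // s Ts st; have := dP s Ts st; rewrite (delta_deriv_jump Tt dF).
rewrite -normrN; congr (`|_| <= _); rewrite /mu; ring.
Qed.

Lemma delta_deriv_continuous (R : realType) (T : set R) (F : R -> R) (t l e : R) :
  T t -> is_delta_deriv T F t l -> 0 < e ->
  exists2 d : R, 0 < d & forall s, T s -> `|s - t| < d -> `|F s - F t| < e.
Proof.
(* [M] dominates [|sigma T t - s|] once [|s - t| < 1], and [M - 1] dominates [|l|]. With tolerance
   [e / (M *+ 2)] the remainder and the linear term each contribute at most [e / 2], the second
   strictly less. *)
move=> Tt dF e0; set M := `|mu T t| + 1 + `|l|.
have M0 : 0 < M by rewrite /M ltr_wpDr // ltr_wpDl.
have eM : 0 < e / (M *+ 2) by rewrite divr_gt0 // mulrn_wgt0.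
have [d d0 dP] := delta_deriv_expand Tt dF eM.
exists (Num.min d (Num.min 1 (e / (M *+ 2)))); first by rewrite !lt_min d0 ltr01 eM.
move=> s Ts; rewrite !lt_min => /and3P[sd s1 se].
have sM : `|sigma T t - s| <= M.
  have -> : sigma T t - s = mu T t - (s - t) by rewrite /mu; ring.
  apply: (le_trans (ler_normB _ _)); rewrite /M -addrA lerD2l.
  by apply: (le_trans (ltW s1)); rewrite lerDl.
have h1 : `|F s - F t - l * (s - t)| <= e / 2.
  apply: (le_trans (dP s Ts sd)).
  apply: (le_trans (ler_wpM2l (ltW eM) sM)).
  by rewrite le_eqVlt; apply/orP; left; apply/eqP; field; lra.
have h2 : `|l * (s - t)| < e / 2.
  rewrite normrM; apply: (@le_lt_trans _ _ ((M - 1) * `|s - t|)).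
    by apply: ler_wpM2r => //; rewrite /M; have := normr_ge0 (mu T t); lra.
  apply: (@le_lt_trans _ _ ((M - 1) * (e / (M *+ 2)))).
    apply: ler_wpM2l; last exact: ltW.
    by rewrite /M; have := normr_ge0 (mu T t); have := normr_ge0 l; lra.
  have -> : e / 2 = M * (e / (M *+ 2)) by field; lra.
  by rewrite ltr_pM2r //; lra.
have -> : F s - F t = (F s - F t - l * (s - t)) + l * (s - t) by ring.
apply: (le_lt_trans (ler_normD _ _)); lra.
Qed.

Lemma delta_deriv_cst (R : realType) (T : set R) (k t : R) :
  is_delta_deriv T (fun=> k) t 0.
Proof.
move=> e e0; apply/near_within_nbhsP; exists 1 => // s _ _.
by rewrite subrr mul0r subrr normr0 mulr_ge0 // ltW.
Qed.

Lemma delta_deriv_id (R : realType) (T : set R) (t : R) :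
  is_delta_deriv T id t 1.
Proof.
move=> e e0; apply/near_within_nbhsP; exists 1 => // s _ _.
by rewrite mul1r subrr normr0 mulr_ge0 // ltW.
Qed.

Lemma delta_derivD (R : realType) (T : set R) (F G : R -> R) (t l k : R) :
  is_delta_deriv T F t l -> is_delta_deriv T G t k ->
  is_delta_deriv T (fun s => F s + G s) t (l + k).
Proof.
move=> dF dG e e0; have e2 : 0 < e / 2 by rewrite divr_gt0.
have /near_within_nbhsP[d d0 dP] := dF _ e2.
have /near_within_nbhsP[f f0 fP] := dG _ e2.
apply/near_within_nbhsP; exists (Num.min d f); first by rewrite lt_min d0.
move=> s Ts; rewrite lt_min => /andP[sd sf].
have := dP s Ts sd; have := fP s Ts sf; set x := `|sigma T t - s|.
move=> h1 h2.
have -> : F (sigma T t) + G (sigma T t) - (F s + G s) - (l + k) * (sigma T t - s)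
  = (F (sigma T t) - F s - l * (sigma T t - s)) +
    (G (sigma T t) - G s - k * (sigma T t - s)) by ring.
apply: (le_trans (ler_normD _ _)); lra.
Qed.

Lemma delta_derivZ (R : realType) (T : set R) (F : R -> R) (c t l : R) :
  is_delta_deriv T F t l -> is_delta_deriv T (fun s => c * F s) t (c * l).
Proof.
move=> dF e e0; have k0 : 0 < `|c| + 1 by rewrite ltr_wpDl.
have /near_within_nbhsP[d d0 dP] := dF _ (divr_gt0 e0 k0).
apply/near_within_nbhsP; exists d => // s Ts sd.
have := dP s Ts sd; set x := `|sigma T t - s| => h.
have -> : c * F (sigma T t) - c * F s - c * l * (sigma T t - s)
  = c * (F (sigma T t) - F s - l * (sigma T t - s)) by ring.
rewrite normrM; apply: (@le_trans _ _ ((`|c| + 1) * (e / (`|c| + 1) * x))).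
  by apply: ler_pM => //; rewrite lerDl.
by rewrite mulrA mulrCA divff ?mulr1 // gt_eqF.
Qed.

Lemma delta_derivN (R : realType) (T : set R) (F : R -> R) (t l : R) :
  is_delta_deriv T F t l -> is_delta_deriv T (fun s => - F s) t (- l).
Proof.
move=> dF e /dF; apply: filterS => s.
rewrite -[X in _ -> X <= _]normrN; congr (`|_| <= _); ring.
Qed.

Lemma delta_derivV (R : realType) (T : set R) (F : R -> R) (t l : R) :
  T t -> F t != 0 -> F (sigma T t) != 0 -> is_delta_deriv T F t l ->
  is_delta_deriv T (fun s => (F s)^-1) t (- (l / (F t * F (sigma T t)))).
Proof.
Proof.
move=> Tt Ft0 Fs0 dF e e0; set a := F t; set b := F (sigma T t).
have a0 : 0 < `|a| by rewrite normr_gt0.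
have b0 : 0 < `|b| by rewrite normr_gt0.
have l0 : 0 < `|l| + 1 by rewrite ltr_wpDl.
(* [K * |w|] is the budget for the numerator of the error, written over the denominator [a * b * y].
   Half goes to the variation [y - a], half to the first-order error of [F]. The bound
   [|y| >= |a| / 2] makes [K] at most [e * |a * b * y|]. *)
pose K := e * (`|a| ^+ 2 * `|b| / 2).
have K0 : 0 < K by rewrite !mulr_gt0 // exprn_gt0.
have e10 : 0 < K / 2 / `|a| by rewrite !divr_gt0.
pose eta := Num.min (`|a| / 2) (K / 2 / (`|l| + 1)).
have eta0 : 0 < eta by rewrite lt_min !divr_gt0.
have /near_within_nbhsP[d d0 dP] := dF _ e10.
have [d' d'0 d'P] := delta_deriv_continuous Tt dF eta0.
apply/near_within_nbhsP; exists (Num.min d d'); first by rewrite lt_min d0.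
move=> s Ts; rewrite lt_min => /andP[sd sd'].
have h1 := dP s Ts sd; have := d'P s Ts sd'; rewrite lt_min => /andP[h2 h3].
rewrite -/a -/b in h1 h2 h3 *; set y := F s in h1 h2 h3 *.
set w := sigma T t - s in h1 *.
have ya : `|a| / 2 <= `|y| by have := ler_normB y (y - a); rewrite subKr; lra.
have y0 : y != 0 by rewrite -normr_gt0; lra.
have -> : b^-1 - y^-1 - - (l / (a * b)) * w =
    (l * (y - a) * w - a * (b - y - l * w)) / (a * b * y).
  by field; rewrite Ft0 Fs0 y0.
have ab0 : 0 < `|a * b * y| by rewrite normr_gt0 !mulf_neq0.
rewrite normf_div ler_pdivrMr //.
apply: (@le_trans _ _ (K * `|w|)).
  apply: (le_trans (ler_normB _ _)).
  have -> : K * `|w| = K / 2 * `|w| + K / 2 * `|w| by field.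
  rewrite lerD //.
    rewrite !normrM ler_wpM2r //.
    apply: (@le_trans _ _ ((`|l| + 1) * (K / 2 / (`|l| + 1)))).
      by apply: ler_pM => //; [rewrite lerDl|exact: ltW].
    by rewrite mulrCA divff ?mulr1 // gt_eqF.
  rewrite normrM; apply: (le_trans (ler_wpM2l (ltW a0) h1)).
  by rewrite mulrA mulrCA divff ?mulr1 // gt_eqF.
have -> : e * `|w| * `|a * b * y| = e * (`|a| * `|b| * `|y|) * `|w|.
  by rewrite !normrM; ring.
rewrite /K ler_wpM2r // ler_pM2l //.
have -> : `|a| ^+ 2 * `|b| / 2 = `|a| * `|b| * (`|a| / 2) by field.
by rewrite ler_pM2l ?mulr_gt0.
Qed.

(** Induction along [T] proves the inequality with a slack [e * (t - a)], which absorbs the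
    first-order error at right-dense points; then [e] tends to 0. *)
Lemma delta_deriv_le (R : realType) (T : set R) (H h : R -> R) (a b : R) :
  closed T -> unbounded_above T -> T a -> T b -> a <= b ->
  (forall t, T t -> a <= t -> t <= b -> is_delta_deriv T H t (h t)) ->
  (forall t, T t -> a <= t -> t < b -> 0 <= h t) ->
  H a <= H b.
Proof.
move=> Tc Tu Ta Tb ab dH h0.
suff Heps e : 0 < e -> forall t, T t -> a <= t -> t <= b ->
    H a <= H t + e * (t - a).
  apply/ler_addgt0Pr => e e0.
  have k0 : 0 < b - a + 1 by lra.
  have := Heps _ (divr_gt0 e0 k0) b Tb ab (lexx _) => /le_trans; apply.
  rewrite lerD2l mulrAC ler_pdivrMr // ler_pM2l //; lra.
move=> e0; apply: (time_scale_ind Tc Tu Ta).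
- by move=> _; rewrite subrr mulr0 addr0.
- move=> t Tt at_ IH lt_ts tsb; have tb : t < b by exact: lt_le_trans tsb.
  have := delta_deriv_jump Tt (dH t Tt at_ (ltW tb)).
  have := IH (ltW tb); rewrite /mu; have := h0 t Tt at_ tb.
  have : 0 < sigma T t - t by lra.
  by nra.
- move=> t Tt at_ IH st; have [tb|bt] := ltP t b; last first.
    by apply/near_within_nbhsP; exists 1 => // s _ _ ts sb; lra.
  have [d d0 dP] := delta_deriv_expand Tt (dH t Tt at_ (ltW tb)) e0.
  apply/near_within_nbhsP; exists d => // s Ts sd ts _.
  have := dP s Ts sd; rewrite st (distrC t s) (gtr0_norm (x := s - t)) ?subr_gt0 //.
  rewrite ler_norml => /andP[lo _].
  have := h0 t Tt at_ tb; have := IH (ltW tb). have : 0 < s - t by lra.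
  by nra.
- move=> t Tt at_ ld IH tb; apply/ler_addgt0Pr => e' e'0.
  have [d d0 dP] := delta_deriv_continuous Tt (dH t Tt (ltW at_) tb) e'0.
  have [s [Ts /andP[sm st]]] := ld (Num.max a (t - d)) ltac:(rewrite gt_max; lra).
  move: sm; rewrite gt_max => /andP[sa sdt].
  have := dP s Ts; rewrite ltr0_norm ?subr_lt0 // => /(_ ltac:(lra)).
  rewrite ltr_norml => /andP[_ hi].
  have := IH s Ts (ltW sa) st (ltW (lt_le_trans st tb)).
  have : 0 < t - s by lra.
  by nra.
Qed.

(** Both [G + F] and [G - F] have a nonnegative delta derivative. The bound is asked only for
    [t < b], where [sigma T t <= b], so that it may involve an exponential started at
    [sigma T t]. *)
Lemma delta_mean_value (R : realType) (T : set R) (F f G g : R -> R) (a b : R) :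
  closed T -> unbounded_above T -> T a -> T b -> a <= b ->
  (forall t, T t -> a <= t -> t <= b -> is_delta_deriv T F t (f t)) ->
  (forall t, T t -> a <= t -> t <= b -> is_delta_deriv T G t (g t)) ->
  (forall t, T t -> a <= t -> t < b -> `|f t| <= g t) ->
  `|F b - F a| <= G b - G a.
Proof.
move=> Tc Tu Ta Tb ab dF dG fg; rewrite ler_norml; apply/andP; split.
  suff : G a + F a <= G b + F b by lra.
  apply: (@delta_deriv_le _ T (fun s => G s + F s) (fun s => g s + f s)) => //.
    by move=> t Tt at_ tb; apply: delta_derivD; [exact: dG|exact: dF].
  by move=> t Tt at_ tb; have := fg t Tt at_ tb; rewrite ler_norml; lra.
suff : G a + - F a <= G b + - F b by lra.
apply: (@delta_deriv_le _ T (fun s => G s + - F s) (fun s => g s + - f s)) => //.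
  by move=> t Tt at_ tb; apply: delta_derivD; [exact: dG|apply: delta_derivN; exact: dF].
by move=> t Tt at_ tb; have := fg t Tt at_ tb; rewrite ler_norml; lra.
Qed.

(** * Decaying exponentials *)

Definition scalar_solves (R : realType) (T : set R) (c : R) (x : R -> R) :=
  forall r, T r -> is_delta_deriv T x r (c * x r).

Lemma scalar_solvesZ (R : realType) (T : set R) (c k : R) (x : R -> R) :
  scalar_solves T c x -> scalar_solves T c (fun s => k * x s).
Proof. by move=> sx r Tr; rewrite mulrCA; apply: delta_derivZ; exact: sx. Qed.

Lemma scalar_solvesB (R : realType) (T : set R) (c : R) (x y : R -> R) :
  scalar_solves T c x -> scalar_solves T c y ->
  scalar_solves T c (fun s => x s + - y s).
Proof.
move=> sx sy r Tr; rewrite mulrDr mulrN.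
by apply: delta_derivD; [exact: sx|apply: delta_derivN; exact: sy].
Qed.

(* A positive level e cannot be crossed upwards: at a right-dense point where
   x = e the delta derivative is - l * e < 0. *)
Lemma decay_le (R : realType) (T : set R) (l e a : R) (x : R -> R) :
  closed T -> unbounded_above T -> 0 < l -> positively_regressive T (- l) ->
  scalar_solves T (- l) x -> T a -> 0 < e -> x a <= e ->
  forall t, T t -> a <= t -> x t <= e.
Proof.
move=> Tc Tu l0 preg sx Ta e0 xa; apply: (time_scale_ind Tc Tu Ta) => //.
- move=> t Tt _ xe ts; rewrite (delta_deriv_jump Tt (sx t Tt)).
  have := preg t Tt; have : 0 < mu T t by rewrite subr_gt0.
  move: (mu T t) => m m0 p.
  (* If [x t <= 0], positive regressivity keeps the jump value [x t * (1 - l * m)] nonpositive;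
     otherwise the jump only decreases [x]. *)
  have [x0|x0] := leP (x t) 0; first by nra.
  have : 0 <= l * x t * m by rewrite !mulr_ge0 // ltW.
  by lra.
- move=> t Tt _; rewrite le_eqVlt => /predU1P[xe|xe] st.
    have le0 : 0 < l * e by rewrite mulr_gt0.
    have [d d0 dP] := delta_deriv_expand Tt (sx t Tt) le0.
    apply/near_within_nbhsP; exists d => // s Ts sd ts.
    have := dP s Ts sd; rewrite st (distrC t s) xe (gtr0_norm (x := s - t)) ?subr_gt0 //.
    by rewrite ler_norml => /andP[_]; lra.
  have [d d0 dP] := delta_deriv_continuous Tt (sx t Tt) (e := e - x t) ltac:(lra).
  apply/near_within_nbhsP; exists d => // s Ts sd _.
  by have := dP s Ts sd; rewrite ltr_norml; lra.
- move=> t Tt at_ ld IH; apply/ler_addgt0Pr => e' e'0.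
  have [d d0 dP] := delta_deriv_continuous Tt (sx t Tt) e'0.
  have [s [Ts /andP[sm st]]] := ld (Num.max a (t - d)) ltac:(rewrite gt_max; lra).
  move: sm; rewrite gt_max => /andP[sa sdt].
  have := dP s Ts; rewrite ltr0_norm ?subr_lt0 // => /(_ ltac:(lra)).
  by have := IH s Ts (ltW sa) st; rewrite ltr_norml; lra.
Qed.

(** By [decay_le], every positive level bounds both [x] and [- x]. By linearity this is uniqueness
    forward in time. *)
Lemma scalar_solves_eq0 (R : realType) (T : set R) (l a : R) (x : R -> R) :
  closed T -> unbounded_above T -> 0 < l -> positively_regressive T (- l) ->
  scalar_solves T (- l) x -> T a -> x a = 0 ->
  forall t, T t -> a <= t -> x t = 0.
Proof.
move=> Tc Tu l0 preg sx Ta xa t Tt at_; apply/eqP; rewrite eq_le.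
apply/andP; split; apply/ler_addgt0Pr => e e0.
  by rewrite add0r; apply: (decay_le Tc Tu l0 preg sx Ta e0) => //; rewrite xa ltW.
have := @decay_le _ T l e a _ Tc Tu l0 preg (scalar_solvesZ (-1) sx) Ta e0.
by rewrite /= xa mulr0 => /(_ (ltW e0) t Tt at_); lra.
Qed.

(** A jump multiplies [x] by the positive factor [1 - mu T t * l]. The delicate case is a left limit
    of positive values, which could a priori be 0. *)
Lemma scalar_solves_gt0 (R : realType) (T : set R) (l a : R) (x : R -> R) :
  closed T -> unbounded_above T -> 0 < l -> positively_regressive T (- l) ->
  scalar_solves T (- l) x -> T a -> 0 < x a ->
  forall t, T t -> a <= t -> 0 < x t.
Proof.
move=> Tc Tu l0 preg sx Ta xa; apply: (time_scale_ind Tc Tu Ta) => //.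
- move=> t Tt _ x0 ts; rewrite (delta_deriv_jump Tt (sx t Tt)).
  have -> : x t + - l * x t * mu T t = x t * (1 + mu T t * - l) by ring.
  by rewrite mulr_gt0 // preg.
- move=> t Tt _ x0 st.
  have [d d0 dP] := delta_deriv_continuous Tt (sx t Tt) x0.
  apply/near_within_nbhsP; exists d => // s Ts sd _.
  by have := dP s Ts sd; rewrite ltr_norml; lra.
- move=> t Tt at_ ld IH.
  (* If 0 < t - r < 1 / l then x <= x r after r, so the slope of x is at least
     - l * x r on [r, t] and x t >= x r * (1 - l * (t - r)) > 0. *)
  have li : 0 < l^-1 by rewrite invr_gt0.
  have [r [Tr /andP[rm rt]]] := ld (Num.max a (t - l^-1)) ltac:(rewrite gt_max; lra).
  move: rm; rewrite gt_max => /andP[ar rtl].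
  have xr := IH r Tr (ltW ar) rt.
  have xle := decay_le Tc Tu l0 preg sx Tr xr (lexx _).
  have : x r + l * x r * r <= x t + l * x r * t.
    apply: (@delta_deriv_le _ T (fun s => x s + l * x r * s)
      (fun s => - l * x s + l * x r * 1)) => //; first exact: ltW.
      move=> s Ts _ _; apply: delta_derivD; first exact: sx.
      by apply: delta_derivZ; exact: delta_deriv_id.
    by move=> s Ts rs _; have := xle s Ts rs; nra.
  have : 0 < x r * (1 - l * (t - r)).
    rewrite mulr_gt0 // subr_gt0 mulrC -ltr_pdivlMr // div1r; lra.
  by lra.
Qed.

Lemma ts_exp_ge0 (R : realType) (T : set R) (l s t : R) :
  closed T -> unbounded_above T -> 0 < l -> positively_regressive T (- l) ->
  T s -> T t -> s <= t -> 0 <= ts_exp T (- l) t s.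
Proof.
move=> Tc Tu l0 preg Ts Tt st; rewrite /ts_exp; case: xgetP => // y _ [sy ys].
by apply/ltW/(scalar_solves_gt0 Tc Tu l0 preg sy Ts _ Tt st); rewrite ys.
Qed.

(** Reduces the two-parameter exponential to a single solution: by forward uniqueness, whichever
    solution [xget] selects agrees with [x / x s] from [s] on. *)
Lemma ts_expE (R : realType) (T : set R) (l s t : R) (x : R -> R) :
  closed T -> unbounded_above T -> 0 < l -> positively_regressive T (- l) ->
  scalar_solves T (- l) x -> T s -> T t -> s <= t -> x s != 0 ->
  ts_exp T (- l) t s = x t / x s.
Proof.
move=> Tc Tu l0 preg sx Ts Tt st xs.
have sz := scalar_solvesZ (x s)^-1 sx.
rewrite /ts_exp; case: xgetP => [y _ [sy ys]|]; last first.
  by move=> /(_ (fun r => (x s)^-1 * x r)) []; split => //; rewrite mulVf.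
have := scalar_solves_eq0 Tc Tu l0 preg (scalar_solvesB sy sz) Ts.
rewrite ys mulVf // subrr => /(_ erefl t Tt st) /eqP; rewrite subr_eq0 => /eqP ->.
by rewrite mulrC.
Qed.

(* e(t, s) / l is an antiderivative of e(t, sigma s) in s, so the integral of
   e(t, sigma s) over [a, t] is (1 - e(t, a)) / l. *)
Lemma ts_exp_integral_le (R : realType) (T : set R) (l K a t : R)
    (F f : R -> R) :
  closed T -> unbounded_above T -> 0 < l -> positively_regressive T (- l) ->
  T a -> T t -> a <= t -> 0 <= K -> delta_antideriv T f F ->
  (forall s, T s -> a <= s -> s < t ->
     `|f s| <= K * ts_exp T (- l) t (sigma T s)) ->
  `|F t - F a| <= K / l.
Proof.
move=> Tc Tu l0 preg Ta Tt at_ K0 dF fK.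
(* If no solution takes the value 1 at a point of [T] from [a] on, every exponential in the bound is
   the default 0, so [f] vanishes before [t] and [F t = F a]. *)
have [[y [r [Tr ar sy yr]]]|noexp] := pselect (exists y r,
    [/\ T r, a <= r, scalar_solves T (- l) y & y r = 1]); last first.
  apply: (@le_trans _ _ 0); last by rewrite divr_ge0 // ltW.
  have -> : 0 = (fun=> 0 : R) t - (fun=> 0 : R) a :> R by rewrite subrr.
  apply: (@delta_mean_value _ T F f (fun=> 0) (fun=> 0)) => //.
    by move=> s Ts _ _; exact: dF.
    by move=> s Ts _ _; exact: delta_deriv_cst.
  move=> s Ts as_ st; apply: (le_trans (fK s Ts as_ st)).
  rewrite /ts_exp xgetPN ?mulr0 // => z [sz zs]; apply: noexp.
  exists z, (sigma T s); split => //; first exact: sigma_in.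
  by apply: (le_trans as_); exact: sigma_ge.
(* Forward uniqueness from [a] rules out [y a = 0], so the solution can be normalised at [a] instead
   of [r]. *)
have ya0 : y a != 0.
  apply/eqP => ya0; have := scalar_solves_eq0 Tc Tu l0 preg sy Ta ya0 Tr ar.
  by rewrite yr => /eqP; rewrite oner_eq0.
pose x s := (y a)^-1 * y s.
have sx : scalar_solves T (- l) x by exact: scalar_solvesZ.
have xa : x a = 1 by rewrite /x mulVf.
have x0 s : T s -> a <= s -> 0 < x s.
  by apply: (scalar_solves_gt0 Tc Tu l0 preg sx Ta); rewrite xa.
have xs0 s : T s -> a <= s -> x (sigma T s) != 0.
  move=> Ts as_; rewrite gt_eqF // x0 //; first exact: sigma_in.
  by apply: (le_trans as_); exact: sigma_ge.
have xt0 := x0 t Tt at_.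
(* The comparison function is [K / l] times [x t / x s], that is e(t, s); by the reciprocal rule its
   delta derivative is [K * x t / x (sigma T s)]. *)
have mv : `|F t - F a| <= K * x t / l * (x t)^-1 - K * x t / l * (x a)^-1.
  apply: (@delta_mean_value _ T F f (fun s => K * x t / l * (x s)^-1)
    (fun s => K * x t / l * - (- l * x s / (x s * x (sigma T s))))) => //.
    by move=> s Ts _ _; exact: dF.
    move=> s Ts as_ _; apply: delta_derivZ; apply: delta_derivV => //.
    - by rewrite gt_eqF // x0.
    - exact: xs0.
    - exact: sx.
  move=> s Ts as_ st; apply: (le_trans (fK s Ts as_ st)).
  rewrite (ts_expE Tc Tu l0 preg sx) ?sigma_le ?xs0 //; last exact: sigma_in.
  rewrite le_eqVlt; apply/orP; left; apply/eqP; field.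
  by rewrite xs0 // !gt_eqF // x0.
apply: (le_trans mv); rewrite xa invr1 mulr1.
have -> : K * x t / l * (x t)^-1 = K / l by field; rewrite !gt_eqF.
by rewrite gerBl; apply: divr_ge0; [apply: mulr_ge0|]; rewrite ?(ltW l0) ?(ltW xt0).
Qed.

(** * Euclidean and operator norms *)

Lemma enorm_ge0 (R : realType) (n : nat) (x : 'cV[R]_n) : 0 <= enorm x.
Proof. exact: sqrtr_ge0. Qed.

Lemma enorm_coord_le (R : realType) (n : nat) (x : 'cV[R]_n) i :
  `|x i 0| <= enorm x.
Proof.
rewrite -sqrtr_sqr ler_wsqrtr // (bigD1 i) //= lerDl.
by apply: sumr_ge0 => j _; exact: sqr_ge0.
Qed.

(** Reduces the vector response to scalar delta integrals. The factor [n%:R], cruder than its square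
    root, is harmless because the gain only has to be finite. *)
Lemma enorm_le_coord (R : realType) (n : nat) (x : 'cV[R]_n) (k : R) :
  0 <= k -> (forall i, `|x i 0| <= k) -> enorm x <= n%:R * k.
Proof.
move=> k0 xk; rewrite -[leRHS]ger0_norm ?mulr_ge0 // -sqrtr_sqr ler_wsqrtr //.
apply: (@le_trans _ _ (n%:R * k ^+ 2)).
  rewrite mulr_natl -[X in _ *+ X]card_ord -sumr_const ler_sum // => i _.
  by rewrite -real_normK ?num_real // lerXn2r ?nnegrE.
rewrite exprMn ler_wpM2r ?sqr_ge0 // -natrX ler_nat.
by case: n {x xk} => // n; rewrite leq_pmulr.
Qed.

Lemma enormZ (R : realType) (n : nat) (a : R) (x : 'cV[R]_n) :
  enorm (a *: x) = `|a| * enorm x.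
Proof.
rewrite /enorm -sqrtr_sqr -sqrtrM ?sqr_ge0 // mulr_sumr; congr Num.sqrt.
by apply: eq_bigr => i _; rewrite mxE exprMn.
Qed.

Lemma enorm_eq0 (R : realType) (n : nat) (x : 'cV[R]_n) : enorm x = 0 -> x = 0.
Proof.
move=> x0; apply/matrixP => i j; rewrite ord1 mxE; apply/eqP.
by rewrite -normr_le0 -x0 enorm_coord_le.
Qed.

(** Makes the [sup] in [opnorm] a genuine supremum: on the unit ball the sum of all [|M i j|] bounds
    each coordinate of [M *m x]. *)
Lemma opnorm_has_ubound (R : realType) (m n : nat) (M : 'M[R]_(m, n)) :
  has_ubound [set enorm (M *m x) | x in [set x : 'cV[R]_n | enorm x <= 1]].
Proof.
exists (m%:R * \sum_i \sum_j `|M i j|) => _ [x x1 <-].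
have S0 i : 0 <= \sum_j `|M i j| by exact: sumr_ge0.
apply: enorm_le_coord => [|i]; first exact: sumr_ge0.
apply: (@le_trans _ _ (\sum_j `|M i j|)).
  rewrite mxE; apply: (le_trans (ler_norm_sum _ _ _)); apply: ler_sum => j _.
  rewrite normrM ler_piMr //; apply: le_trans x1; exact: enorm_coord_le.
by rewrite [leRHS](bigD1 i) //= lerDl; exact: sumr_ge0.
Qed.

Lemma enorm_mulmx_le (R : realType) (m n : nat) (M : 'M[R]_(m, n))
  (x : 'cV[R]_n) : enorm (M *m x) <= opnorm M * enorm x.
Proof.
have [/enorm_eq0 ->|x0] := eqVneq (enorm x) 0.
  rewrite mulmx0 /enorm !big1 ?sqrtr0 ?mulr0 // => i _; by rewrite mxE expr0n.
have xgt : 0 < enorm x by rewrite lt_def x0 enorm_ge0.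
rewrite -ler_pdivrMr // mulrC.
have -> : (enorm x)^-1 * enorm (M *m x) = enorm (M *m ((enorm x)^-1 *: x)).
  by rewrite -scalemxAr enormZ ger0_norm // invr_ge0 ltW.
apply: (ub_le_sup (opnorm_has_ubound M)); exists ((enorm x)^-1 *: x) => //=.
by rewrite enormZ ger0_norm ?mulVf // invr_ge0 ltW.
Qed.

Lemma opnorm_ge0 (R : realType) (m n : nat) (M : 'M[R]_(m, n)) : 0 <= opnorm M.
Proof.
apply: (@le_trans _ _ (enorm (M *m 0))); first exact: enorm_ge0.
apply: (ub_le_sup (opnorm_has_ubound M)); exists 0 => //=.
by rewrite -[0](scale0r (0 : 'cV_n)) enormZ normr0 mul0r.
Qed.

(** * The state equation *)

Lemma delta_deriv_sum (R : realType) (T : set R) (I : Type) (r : seq I)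
    (F : I -> R -> R) (t : R) (l : I -> R) :
  (forall i, is_delta_deriv T (F i) t (l i)) ->
  is_delta_deriv T (fun s => \sum_(i <- r) F i s) t (\sum_(i <- r) l i).
Proof.
move=> dF; elim: r => [|i r IH].
  under eq_fun do rewrite big_nil; rewrite big_nil; exact: delta_deriv_cst.
under eq_fun do rewrite big_cons; rewrite big_cons.
exact: delta_derivD.
Qed.

(** Turns a matrix solution into vector trajectories, for which the stability hypothesis is
    stated. *)
Lemma solves_mulmx (R : realType) (T : set R) (n k j : nat) (A : R -> 'M[R]_n)
    (X : R -> 'M[R]_(n, k)) (V : 'M[R]_(k, j)) :
  solves T A X -> solves T A (fun s => X s *m V).
Proof.
move=> sX t Tt i c; rewrite mulmxA mxE; under eq_fun do rewrite mxE.
apply: delta_deriv_sum => h; rewrite mulrC; under eq_fun do rewrite mulrC.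
apply: delta_derivZ; exact: sX.
Qed.

(** The stability estimate for the trajectory [X *m v], which starts from [v] at time [s]. *)
Lemma enorm_transition_le (R : realType) (T : set R) (n : nat)
    (A : R -> 'M[R]_n) (g l : R) (s t : R) (v : 'cV[R]_n) :
  closed T -> unbounded_above T -> 0 < g -> 0 < l ->
  positively_regressive T (- l) ->
  (forall (t0 : R) (x : R -> 'cV[R]_n), T t0 -> solves T A x ->
      forall t, T t -> t0 <= t ->
        enorm (x t) <= enorm (x t0) * g * ts_exp T (- l) t t0) ->
  T s -> T t -> s <= t ->
  enorm (transition T A t s *m v) <= enorm v * g * ts_exp T (- l) t s.
Proof.
move=> Tc Tu g0 l0 preg ues Ts Tt st; rewrite /transition.
case: xgetP => [X _ [sX Xs]|_].
  have := ues s _ Ts (solves_mulmx v sX) t Tt st.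
  by rewrite Xs mul1mx.
rewrite mul0mx -[0](scale0r (0 : 'cV_n)) enormZ normr0 mul0r.
by rewrite mulr_ge0 ?ts_exp_ge0 // mulr_ge0 ?enorm_ge0 // ltW.
Qed.

Unset Implicit Arguments.
Set Strict Implicit.

Theorem theorem5p7 (R : realType) (T : set R) (n m p : nat)
    (A : R -> 'M[R]_n) (B : R -> 'M[R]_(n, m)) (C : R -> 'M[R]_(p, n))
    (alpha beta : R)
    (T_ts : time_scale T) (T_unbounded : unbounded_above T)
    (T_grain : bounded_graininess T)
    (A_rd : rd_continuous_mx T A) (B_rd : rd_continuous_mx T B)
    (C_rd : rd_continuous_mx T C) (A_reg : regressive T A)
    (ues : uniformly_exp_stable T A)
    (B_bound : forall t, T t -> opnorm (B t) <= beta)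
    (C_bound : forall t, T t -> opnorm (C t) <= alpha) :
  uniformly_BIBO_stable T A B C.
Proof.
have Tu := T_unbounded; have [Tc [t1 Tt1]] := T_ts.
have [g [l [g0 l0 preg stable]]] := ues.
have alpha0 : 0 <= alpha := le_trans (opnorm_ge0 _) (C_bound _ Tt1).
have beta0 : 0 <= beta := le_trans (opnorm_ge0 _) (B_bound _ Tt1).
(* [k] is the gain of each coordinate of the response: [alpha * (beta * g)] comes from the integrand
   and [1 / l] from integrating the exponential. Passing to the Euclidean norm costs the factor
   [p%:R]. *)
pose k := alpha * (beta * g) / l.
have k0 : 0 <= k by rewrite /k !mulr_ge0 ?invr_ge0 // ltW.
have pk0 : 0 < p%:R * k + 1 by rewrite ltr_wpDl // mulr_ge0.
(* The added 1 keeps eta positive, so that eta * +oo = +oo. *)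
exists (p%:R * k + 1) => t0 u Tt0 _.
have ubN s : T s -> t0 <= s -> ((enorm (u s))%:E <= sup_norm_from T t0 u)%E.
  by move=> Ts ts; apply: ereal_sup_ubound; exists s.
apply: ge_ereal_sup => _ [t [Tt t0t] <-].
(* The value -oo is impossible because [t0] itself contributes to the supremum. *)
case: (sup_norm_from T t0 u) ubN => [N||] ubN; last 2 first.
- by rewrite gt0_muley ?leey // lte_fin.
- by have := ubN t0 Tt0 (lexx _); rewrite leeNy_eq.
have {}ubN s : T s -> t0 <= s -> enorm (u s) <= N.
  by move=> Ts ts; rewrite -lee_fin; exact: ubN.
have N0 : 0 <= N := le_trans (enorm_ge0 _) (ubN t0 Tt0 (lexx _)).
rewrite -EFinM lee_fin.
suff yk i : `|zero_state_response T A B C u t0 t i 0| <= k * N.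
  apply: (le_trans (enorm_le_coord (mulr_ge0 k0 N0) yk)).
  by rewrite mulrA ler_wpM2r // lerDl.
rewrite mxE /delta_integral; case: xgetP => [F _ dF|_]; last first.
  by rewrite subrr normr0 mulr_ge0.
have -> : k * N = alpha * (beta * g) * N / l by rewrite /k mulrAC.
apply: (ts_exp_integral_le Tc Tu l0 preg Tt0 Tt t0t _ dF).
  by rewrite !mulr_ge0 // ltW.
(* An entry is bounded by the norm of the whole integrand, from which [C t], the transition matrix
   and [B s] are peeled off in turn. Since [s < t] gives [sigma T s <= t], the stability estimate
   applies from [sigma T s] to [t]. *)
move=> s Ts t0s st; apply: (le_trans (enorm_coord_le _ _)).
have Tss := sigma_in s Tc Tu.
have sst := sigma_le Tu Tt st.
have e0 := ts_exp_ge0 Tc Tu l0 preg Tss Tt sst.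
rewrite -!mulmxA; apply: (le_trans (enorm_mulmx_le _ _)).
rewrite -!mulrA; apply: ler_pM; rewrite ?opnorm_ge0 ?enorm_ge0 ?C_bound //.
apply: (le_trans (enorm_transition_le (B s *m u s) Tc Tu g0 l0 preg stable Tss Tt sst)).
have Bu : enorm (B s *m u s) <= beta * N.
  apply: (le_trans (enorm_mulmx_le _ _)).
  by apply: ler_pM; rewrite ?opnorm_ge0 ?enorm_ge0 ?B_bound ?ubN.
have -> : beta * (g * (N * ts_exp T (- l) t (sigma T s)))
  = beta * N * g * ts_exp T (- l) t (sigma T s) by ring.
by rewrite !ler_wpM2r // ltW.
Qed.
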